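(* Let $\{\star\}$ be a one-point set. A metrically free (i.e. $\odot$-free) matricially normed space with base $\{\star\}$ exists, and it is $\widehat M_\infty$, the matricial $\ell_1$-sum of the family $\{\widehat M_n : n\in\mathbb N\}$.
   Context: All linear spaces are complex. $M_n$ is the linear space of $n\times n$ complex matrices, $\|\cdot\|_o$ the operator norm on it. For a linear space $E$, $M_n(E)$ is the space of $n\times n$ matrices with entries in $E$ (identified with $M_n\otimes E$); $u\oplus w$ denotes the block-diagonal matrix with blocks $u,w$. The closed unit ball of a normed space $X$ is $B_X$. A matrix-norm on $E$ is a sequence of norms $\|\cdot\|_n$ on $M_n(E)$, $n\in\mathbb N$, such that (Axiom 1) $\|u\oplus 0\|_{n+m}=\|u\|_n$ for $u\in M_n(E)$ and $0\in M_m(E)$; (Axiom 2) $\|Su\|_n\le\|S\|_o\|u\|_n$ and $\|uS\|_n\le\|u\|_n\|S\|_o$ for $u\in M_n(E)$, $S\in M_n$. A matricially normed space is a linear space with a matrix-norm. For a linear operator $\varphi:E\to F$, its $m$-th amplification is $\varphi_m:M_m(E)\to M_m(F)$, $(x_{ij})\mapsto(\varphi(x_{ij}))$. Between matricially normed spaces, $\varphi$ is completely contractive if every $\varphi_m$ is contractive. $\mathbf{MN_1}$ is the category of matricially normed spaces and completely contractive operators. The space $\widehat M_n$: for a linear space $E$ and $v=(x_{ij})\in M_n(E)$ let $\varphi^v:M_n\to E$, $(\lambda_{ij})\mapsto\sum_{i,j}\lambda_{ji}x_{ij}$. $\widehat M_n$ is $M_n$ with the matrix-norm given on $u\in M_m(M_n)$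 by $\|u\|_m:=\sup\|(\varphi^v)_m(u)\|_m$, the supremum taken over all pairs $(E,v)$ with $E$ a matricially normed space and $v\in B_{M_n(E)}$. Matricial $\ell_1$-sum of a family $E_\nu$, $\nu\in\Lambda$, of matricially normed spaces: the algebraic direct sum $E=\bigoplus_\nu E_\nu$ where, for each $m$, $M_m(E)$ is identified with $\bigoplus_\nu M_m(E_\nu)$ and given the $\ell_1$-sum norm $\|(u_\nu)\|=\sum_\nu\|u_\nu\|_m$ (no completion is taken). The functor $\odot:\mathbf{MN_1}\to\mathbf{Set}$ takes $E$ to the cartesian product $\prod_{m=1}^\infty B_{M_m(E)}$ and a morphism $\varphi:E\to F$ to the map $(w_1,\dots,w_m,\dots)\mapsto(\varphi_1(w_1),\dots,\varphi_m(w_m),\dots)$. A matricially normed space $\mathbf{Fr}(M)$ is $\odot$-free (also called metrically free) with base the set $M$ if for every matricially normed space $E$ there is a bijection, natural in $E$, from the set of maps $M\to\odot(E)$ onto the set of completely contractive operators $\mathbf{Fr}(M)\to E$. *)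

(* Defs.v *)
(* The complex numbers are R[i], for an arbitrary model R : realType of the   *)
(* real numbers.                                                              *)
From HB Require Import structures.
From mathcomp Require Import all_boot all_order all_algebra.
From mathcomp Require Import all_classical all_reals.
From mathcomp.real_closed Require Import complex.
From mathcomp Require Import finmap ring lra.

Set Implicit Arguments.
Unset Strict Implicit.
Unset Printing Implicit Defensive.

Import Order.TTheory GRing.Theory Num.Theory.
Import Normc.

Local Open Scope ring_scope.
Local Open Scope complex_scope.
Local Open Scope classical_set_scope.

Section OperatorNorm.
Variable R : realType.

Definition l2norm n (x : 'cV[R[i]]_n) : R :=
  Num.sqrt (\sum_k normc (x k 0) ^+ 2).

Definition opnorm m n (S : 'M[R[i]]_(m, n)) : R :=
  sup [set l2norm (S *m x) | x in [set x : 'cV[R[i]]_n | l2norm x <= 1]].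

End OperatorNorm.

Section ScalarAction.
Variables (K : pzRingType) (E : lmodType K).

Definition mxactl m n p (S : 'M[K]_(m, n)) (u : 'M[E]_(n, p)) : 'M[E]_(m, p) :=
  \matrix_(i, j) \sum_k S i k *: u k j.

Definition mxactr m n p (u : 'M[E]_(m, n)) (S : 'M[K]_(n, p)) : 'M[E]_(m, p) :=
  \matrix_(i, j) \sum_k S k j *: u i k.

(* The scalar multiplication of M_n(E); the library only provides it on       *)
(* matrices over the base ring.                                               *)
Definition mxscale m n (a : K) (u : 'M[E]_(m, n)) : 'M[E]_(m, n) :=
  map_mx (fun x => a *: x) u.

End ScalarAction.

(* The index n = 0 is allowed, but carries no information: 'M[E]_0 = {0}, its *)
(* norm is forced to be 0, and the axioms with a zero index hold trivially.   *)
HB.mixin Record isMatNormed (R : realType) E of GRing.Lmodule R[i] E := {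
  mnorm : forall n, 'M[E]_n -> R;
  mnorm_eq0 : forall n (u : 'M[E]_n), mnorm n u = 0 -> u = 0;
  ler_mnormD : forall n (u w : 'M[E]_n),
    mnorm n (u + w) <= mnorm n u + mnorm n w;
  mnormZ : forall n (a : R[i]) (u : 'M[E]_n),
    mnorm n (mxscale a u) = normc a * mnorm n u;
  mnorm_dsum0 : forall n m (u : 'M[E]_n),
    mnorm (n + m)%N (block_mx u 0 0 (0 : 'M[E]_m)) = mnorm n u;
  mnorm_actl : forall n (S : 'M[R[i]]_n) (u : 'M[E]_n),
    mnorm n (mxactl S u) <= opnorm S * mnorm n u;
  mnorm_actr : forall n (u : 'M[E]_n) (S : 'M[R[i]]_n),
    mnorm n (mxactr u S) <= mnorm n u * opnorm S
}.

#[short(type="matNormedType")]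
HB.structure Definition MatNormed (R : realType) :=
  { E of isMatNormed R E & GRing.Lmodule R[i] E }.

Arguments mnorm {R s n}.
Arguments mnorm_eq0 {R s n}.
Arguments ler_mnormD {R s n}.
Arguments mnormZ {R s n}.
Arguments mnorm_dsum0 {R s n}.
Arguments mnorm_actl {R s n}.
Arguments mnorm_actr {R s n}.

Section MatNormedTheory.
Variables (R : realType) (E : matNormedType R).

Lemma mnorm0 n : mnorm (0 : 'M[E]_n) = 0.
Proof.
have <- : mxscale (0 : R[i]) (0 : 'M[E]_n) = 0.
  by apply/matrixP => i j; rewrite !mxE scale0r.
by rewrite mnormZ normc0 mul0r.
Qed.

Lemma mnorm_ge0 n (u : 'M[E]_n) : 0 <= mnorm u.
Proof.
have := ler_mnormD u (mxscale (-1) u).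
have -> : u + mxscale (-1) u = 0.
  by apply/matrixP => i j; rewrite !mxE scaleN1r subrr.
by rewrite mnorm0 mnormZ normcN normc1 mul1r -mulr2n pmulrn_lge0.
Qed.

Lemma ler_mnorm_sum n (I : Type) (r : seq I) (F : I -> 'M[E]_n) :
  mnorm (\sum_(i <- r) F i) <= \sum_(i <- r) mnorm (F i).
Proof.
elim: r => [|i r IH]; first by rewrite !big_nil mnorm0.
by rewrite !big_cons (le_trans (ler_mnormD _ _))// lerD2l.
Qed.

End MatNormedTheory.

Section OperatorNormTheory.
Variable R : realType.
Local Notation C := R[i].

Lemma normc_ge0 (z : C) : 0 <= normc z.
Proof. by case: z => a b; exact: sqrtr_ge0. Qed.

Lemma l2norm_ge0 n (x : 'cV[C]_n) : 0 <= l2norm x.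
Proof. exact: sqrtr_ge0. Qed.

Lemma sqr_l2norm n (x : 'cV[C]_n) :
  l2norm x ^+ 2 = \sum_k normc (x k 0) ^+ 2.
Proof. by rewrite sqr_sqrtr// sumr_ge0// => k _; exact: sqr_ge0. Qed.

Lemma normc_le_l2norm n (x : 'cV[C]_n) k : normc (x k 0) <= l2norm x.
Proof.
rewrite -(ler_pXn2r (n:=2))// ?nnegrE ?normc_ge0 ?l2norm_ge0//.
rewrite sqr_l2norm (bigD1 k)//= lerDl sumr_ge0// => i _; exact: sqr_ge0.
Qed.

Lemma l2norm_eq0 n (x : 'cV[C]_n) : l2norm x = 0 -> x = 0.
Proof.
move=> x0; apply/colP => k; rewrite mxE; apply: eq0_normc.
by apply/eqP; rewrite eq_le normc_ge0 andbT -x0 normc_le_l2norm.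
Qed.

Lemma l2norm0 n : l2norm (0 : 'cV[C]_n) = 0.
Proof.
rewrite /l2norm big1 ?sqrtr0// => k _.
by rewrite mxE normc0 expr0n.
Qed.

Lemma l2normZ n (a : C) (x : 'cV[C]_n) : l2norm (a *: x) = normc a * l2norm x.
Proof.
rewrite -[in RHS](ger0_norm (normc_ge0 a)) -sqrtr_sqr -sqrtrM ?sqr_ge0//.
by rewrite mulr_sumr; congr Num.sqrt; apply: eq_bigr => k _;
  rewrite mxE normcM exprMn.
Qed.

Lemma ler_l2normD n (x y : 'cV[C]_n) : l2norm (x + y) <= l2norm x + l2norm y.
Proof.
have [/l2norm_eq0->|x0] := eqVneq (l2norm x) 0.
  by rewrite add0r lerDr l2norm_ge0.
have [/l2norm_eq0->|y0] := eqVneq (l2norm y) 0.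
  by rewrite addr0 lerDl l2norm_ge0.
set a := l2norm x in x0 *; set b := l2norm y in y0 *.
have a0 : 0 < a by rewrite lt_neqAle eq_sym x0 l2norm_ge0.
have b0 : 0 < b by rewrite lt_neqAle eq_sym y0 l2norm_ge0.
rewrite -(ler_pXn2r (n:=2))// ?nnegrE ?addr_ge0 ?l2norm_ge0// sqr_l2norm.
have -> : (a + b) ^+ 2 = (1 + b / a) * a ^+ 2 + (1 + a / b) * b ^+ 2.
  by field; rewrite x0 y0.
rewrite !sqr_l2norm !mulr_sumr -big_split/=; apply: ler_sum => k _.
rewrite mxE; set s := normc (x k 0); set t := normc (y k 0).
apply: (@le_trans _ _ ((s + t) ^+ 2)).
  by rewrite ler_pXn2r// ?nnegrE ?addr_ge0 ?normc_ge0// le_normcD.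
rewrite -subr_ge0.
have -> : (1 + b / a) * s ^+ 2 + (1 + a / b) * t ^+ 2 - (s + t) ^+ 2
   = (b * s - a * t) ^+ 2 / (a * b).
  by field; rewrite x0 y0.
by rewrite divr_ge0 ?sqr_ge0// ltW// mulr_gt0.
Qed.

Lemma opnorm_has_sup m n (S : 'M[C]_(m, n)) :
  has_sup [set l2norm (S *m x) | x in [set x : 'cV[C]_n | l2norm x <= 1]].
Proof.
split; first by exists (l2norm (S *m 0)), 0 => //=; rewrite l2norm0.
exists (\sum_k l2norm (col k S)) => _ [x /= x1 <-].
have -> : S *m x = \sum_k x k 0 *: col k S.
  apply/colP => i; rewrite mxE summxE; apply: eq_bigr => k _.
  by rewrite !mxE mulrC.
apply: (@le_trans _ _ (\sum_k l2norm (x k 0 *: col k S))).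
  elim/big_ind2: _ => [|u a w b ua wb|//]; first by rewrite l2norm0.
  by rewrite (le_trans (ler_l2normD _ _))// lerD.
apply: ler_sum => k _; rewrite l2normZ ler_piMl ?l2norm_ge0//.
exact: le_trans (normc_le_l2norm _ _) x1.
Qed.

Lemma opnorm_le m n (S : 'M[C]_(m, n)) c :
  (forall x, l2norm x <= 1 -> l2norm (S *m x) <= c) -> opnorm S <= c.
Proof.
move=> Sc; apply: ge_sup; first by case: (opnorm_has_sup S).
by move=> _ [x /= x1 <-]; exact: Sc.
Qed.

Lemma l2norm_le_opnorm m n (S : 'M[C]_(m, n)) x :
  l2norm x <= 1 -> l2norm (S *m x) <= opnorm S.
Proof. by move=> x1; apply: sup_upper_bound; [exact: opnorm_has_sup|exists x]. Qed.

Lemma opnorm_ge0 m n (S : 'M[C]_(m, n)) : 0 <= opnorm S.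
Proof.
apply: le_trans (l2norm_ge0 (S *m 0)) _.
by apply: l2norm_le_opnorm; rewrite l2norm0.
Qed.

Lemma l2norm_mulmx m n (S : 'M[C]_(m, n)) x :
  l2norm (S *m x) <= opnorm S * l2norm x.
Proof.
have [/l2norm_eq0->|x0] := eqVneq (l2norm x) 0.
  by rewrite mulmx0 !l2norm0 mulr0.
have xp : 0 < l2norm x by rewrite lt_neqAle eq_sym x0 l2norm_ge0.
rewrite -ler_pdivrMr// mulrC.
have nc : normc (l2norm x)^-1%:C = (l2norm x)^-1.
  by rewrite /= expr0n addr0 sqrtr_sqr ger0_norm// invr_ge0 ltW.
rewrite -nc -l2normZ scalemxAr; apply: l2norm_le_opnorm.
by rewrite l2normZ nc mulVf.
Qed.

Lemma opnorm_eq0 m n (S : 'M[C]_(m, n)) : opnorm S = 0 -> S = 0.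
Proof.
move=> S0; apply/matrixP => i j; rewrite mxE.
have : l2norm (S *m delta_mx j 0) <= 0.
  by rewrite (le_trans (l2norm_mulmx _ _))// S0 mul0r.
move=> Sj; have /l2norm_eq0/colP/(_ i) : l2norm (S *m delta_mx j 0) = 0.
  by apply/eqP; rewrite eq_le Sj l2norm_ge0.
by rewrite -colE !mxE.
Qed.

Lemma ler_opnormD m n (S T : 'M[C]_(m, n)) :
  opnorm (S + T) <= opnorm S + opnorm T.
Proof.
apply: opnorm_le => x x1; rewrite mulmxDl (le_trans (ler_l2normD _ _))//.
by rewrite lerD// l2norm_le_opnorm.
Qed.

Lemma ler_opnormZ m n a (S : 'M[C]_(m, n)) :
  opnorm (a *: S) <= normc a * opnorm S.
Proof.
apply: opnorm_le => x x1; rewrite -scalemxAl l2normZ.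
by rewrite ler_wpM2l ?normc_ge0 ?l2norm_le_opnorm.
Qed.

Lemma opnormZ m n a (S : 'M[C]_(m, n)) : opnorm (a *: S) = normc a * opnorm S.
Proof.
apply/eqP; rewrite eq_le ler_opnormZ/=.
have [->|a0] := eqVneq a 0; first by rewrite normc0 mul0r opnorm_ge0.
have na0 : 0 < normc a.
  rewrite lt_neqAle normc_ge0 andbT eq_sym.
  by apply: contra a0 => /eqP/eq0_normc->.
rewrite mulrC -ler_pdivlMr// mulrC -normcV.
by rewrite -{1}(scalerK a0 S) ler_opnormZ.
Qed.

Lemma ler_opnormM m n p (S : 'M[C]_(m, n)) (T : 'M[C]_(n, p)) :
  opnorm (S *m T) <= opnorm S * opnorm T.
Proof.
apply: opnorm_le => x x1; rewrite -mulmxA (le_trans (l2norm_mulmx _ _))//.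
by rewrite ler_wpM2l ?opnorm_ge0 ?l2norm_le_opnorm.
Qed.

Lemma l2norm_col_mx m n (x : 'cV[C]_m) (y : 'cV[C]_n) :
  l2norm (col_mx x y) ^+ 2 = l2norm x ^+ 2 + l2norm y ^+ 2.
Proof.
rewrite !sqr_l2norm big_split_ord /=; congr (_ + _); apply: eq_bigr => k _.
  by rewrite col_mxEu.
by rewrite col_mxEd.
Qed.

Lemma l2norm_col_mx0 m n (x : 'cV[C]_m) :
  l2norm (col_mx x (0 : 'cV[C]_n)) = l2norm x.
Proof.
apply/eqP; rewrite -(@eqrXn2 _ 2) ?l2norm_ge0//.
by rewrite l2norm_col_mx l2norm0 expr0n addr0.
Qed.

Lemma opnorm_dsum0 n m (S : 'M[C]_n) :
  opnorm (block_mx S 0 0 (0 : 'M[C]_m)) = opnorm S.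
Proof.
apply/eqP; rewrite eq_le; apply/andP; split; apply: opnorm_le => x x1.
  rewrite -(vsubmxK x) in x1 *.
  rewrite mul_block_col !mul0mx !addr0 l2norm_col_mx0 l2norm_le_opnorm//.
  rewrite (le_trans _ x1)// -(ler_pXn2r (n:=2))// ?nnegrE ?l2norm_ge0//.
  by rewrite l2norm_col_mx lerDl sqr_ge0.
have := @l2norm_le_opnorm _ _ (block_mx S 0 0 (0 : 'M[C]_m)) (col_mx x 0).
by rewrite mul_block_col !mul0mx !addr0 !l2norm_col_mx0; exact.
Qed.

End OperatorNormTheory.

(* The scalars with the operator norm on each M_n; this space separates the   *)
(* points of M_n in the proof that the norm of \widehat M_n is definite.      *)
Definition opscalar (R : realType) : Type := R[i]^o.
HB.instance Definition _ (R : realType) := GRing.Lmodule.on (opscalar R).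

Section OpScalar.
Variable R : realType.
Local Notation C := R[i].
Local Notation E := (opscalar R).

Let opscalar_eq0 n (u : 'M[E]_n) : opnorm (u : 'M[C]_n) = 0 -> u = 0.
Proof. exact: opnorm_eq0. Qed.

Let opscalar_normD n (u w : 'M[E]_n) :
  opnorm (u + w : 'M[C]_n) <= opnorm (u : 'M[C]_n) + opnorm (w : 'M[C]_n).
Proof. exact: ler_opnormD. Qed.

Let opscalar_normZ n (a : C) (u : 'M[E]_n) :
  opnorm (mxscale a u : 'M[C]_n) = normc a * opnorm (u : 'M[C]_n).
Proof.
by rewrite -opnormZ; congr opnorm; apply/matrixP => i j; rewrite !mxE.
Qed.

Let opscalar_dsum0 n m (u : 'M[E]_n) :
  opnorm (block_mx u 0 0 (0 : 'M[E]_m) : 'M[C]_(n + m)) =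
  opnorm (u : 'M[C]_n).
Proof. exact: opnorm_dsum0. Qed.

Let opscalar_actl n (S : 'M[C]_n) (u : 'M[E]_n) :
  opnorm (mxactl S u : 'M[C]_n) <= opnorm S * opnorm (u : 'M[C]_n).
Proof.
apply: le_trans (ler_opnormM _ _); rewrite le_eqVlt; apply/orP; left.
by apply/eqP; congr opnorm; apply/matrixP => i j; rewrite !mxE.
Qed.

Let opscalar_actr n (u : 'M[E]_n) (S : 'M[C]_n) :
  opnorm (mxactr u S : 'M[C]_n) <= opnorm (u : 'M[C]_n) * opnorm S.
Proof.
apply: le_trans (ler_opnormM _ _); rewrite le_eqVlt; apply/orP; left.
apply/eqP; congr opnorm; apply/matrixP => i j; rewrite !mxE.
by apply: eq_bigr => k _; rewrite mulrC.
Qed.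

HB.instance Definition _ := isMatNormed.Build R E
  opscalar_eq0 opscalar_normD opscalar_normZ opscalar_dsum0
  opscalar_actl opscalar_actr.

End OpScalar.

Section Phi.
Variables (K : comPzRingType) (E : lmodType K) (n : nat).
Implicit Types (v : 'M[E]_n).

Definition phi v (a : 'M[K]_n) : E := \sum_i \sum_j a j i *: v i j.

Lemma phi_is_linear v : linear (phi v).
Proof.
move=> c a b; rewrite /phi scaler_sumr -big_split; apply: eq_bigr => i _.
rewrite scaler_sumr -big_split; apply: eq_bigr => j _.
by rewrite !mxE scalerDl scalerA.
Qed.

HB.instance Definition _ v :=
  GRing.isLinear.Build K 'M[K]_n E *:%R (phi v) (phi_is_linear v).

End Phi.

(* The alias keeps the matrix-norm of \widehat M_n off the bare type of       *)
(* matrices.                                                                  *)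
Definition hatM (R : realType) (n : nat) : Type := 'M[R[i]]_n.
HB.instance Definition _ (R : realType) n := GRing.Lmodule.on (hatM R n).

Section HatNorm.
Variables (R : realType) (n : nat).
Local Notation C := R[i].
Local Notation H := (hatM R n).

(* Nonempty and bounded above, by hat_has_sup, so that sup is not a default   *)
(* value.                                                                     *)
Definition hat_set m (u : 'M[H]_m) : set R :=
  [set r | exists (E : matNormedType R) (v : 'M[E]_n),
     mnorm v <= 1 /\ r = mnorm (map_mx (phi v) u)].

Definition hat_norm m (u : 'M[H]_m) : R := sup (hat_set u).

(* A matrix amplified from size n to size m by rectangular scalar matrices is *)
(* bounded uniformly in E, although the norm axioms only cover square ones.   *)
Lemma mnorm_rect m (A : 'M[C]_(m, n)) (B : 'M[C]_(n, m)) :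
  exists c : R, forall (E : matNormedType R) (v : 'M[E]_n),
    mnorm (mxactr (mxactl A v) B) <= c * mnorm v.
Proof.
have aux p q (e : p = q) (A' : 'M[C]_(p, q)) (B' : 'M[C]_(q, p)) :
    exists c : R, forall (E : matNormedType R) (w : 'M[E]_q),
      mnorm (mxactr (mxactl A' w) B') <= c * mnorm w.
  case: q / e A' B' => A' B'; exists (opnorm A' * opnorm B') => E w.
  rewrite (le_trans (mnorm_actr _ _))// mulrAC ler_wpM2r ?opnorm_ge0//.
  exact: mnorm_actl.
have [c cP] := aux _ _ (addnC m n) (block_mx A 0 0 0) (block_mx B 0 0 0).
exists c => E v; rewrite -(mnorm_dsum0 m v) -(mnorm_dsum0 n).
suff <- : mxactr (mxactl (block_mx A 0 0 0) (block_mx v 0 0 (0 : 'M[E]_m)))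
    (block_mx B 0 0 0) = block_mx (mxactr (mxactl A v) B) 0 0 (0 : 'M[E]_n).
  exact: cP.
have e1 : mxactl (block_mx A 0 0 (0 : 'M[C]_(n, m)))
    (block_mx v 0 0 (0 : 'M[E]_m)) = block_mx (mxactl A v) 0 0 0.
  apply/matrixP => i j; rewrite mxE big_split_ord /=.
  rewrite [X in _ + X]big1 ?addr0; last first.
    move=> k _; case: (split_ordP j) => l ->.
      by rewrite block_mxEdl [X in _ *: X]mxE scaler0.
    by rewrite block_mxEdr [X in _ *: X]mxE scaler0.
  case: (split_ordP i) => a ->; case: (split_ordP j) => b ->.
  - rewrite block_mxEul mxE; apply: eq_bigr => k _.
    by rewrite !block_mxEul.
  - rewrite block_mxEur mxE big1// => k _.
    by rewrite block_mxEul block_mxEur [X in _ *: X]mxE scaler0.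
  - rewrite block_mxEdl mxE big1// => k _.
    by rewrite block_mxEdl [X in X *: _]mxE scale0r.
  - rewrite block_mxEdr mxE big1// => k _.
    by rewrite block_mxEdl [X in X *: _]mxE scale0r.
rewrite e1; apply/matrixP => i j; rewrite mxE big_split_ord /=.
rewrite [X in _ + X]big1 ?addr0; last first.
  move=> k _; case: (split_ordP i) => a ->.
    by rewrite block_mxEur [X in _ *: X]mxE scaler0.
  by rewrite block_mxEdr [X in _ *: X]mxE scaler0.
case: (split_ordP i) => a ->; case: (split_ordP j) => b ->.
- rewrite block_mxEul mxE; apply: eq_bigr => k _.
  by rewrite !block_mxEul.
- rewrite block_mxEur mxE big1// => k _.
  by rewrite block_mxEur [X in X *: _]mxE scale0r.
- rewrite block_mxEdl mxE big1// => k _.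
  by rewrite block_mxEdl [X in _ *: X]mxE scaler0.
- rewrite block_mxEdr mxE big1// => k _.
  by rewrite block_mxEdl [X in _ *: X]mxE scaler0.
Qed.

Lemma map_phiE m (u : 'M[H]_m) (E : matNormedType R) (v : 'M[E]_n) :
  map_mx (phi v) u = \sum_(q : 'I_m) \sum_(j : 'I_n)
    mxactr (mxactl (\matrix_(p, i) (u p q : 'M[C]_n) j i) v) (delta_mx j q).
Proof.
apply/matrixP => p b; rewrite !mxE summxE (bigD1 b)//= summxE.
rewrite [X in _ = _ + X]big1 ?addr0; last first.
  move=> q qb; rewrite summxE big1// => j _; rewrite mxE big1// => k _.
  by rewrite mxE (eq_sym b) (negbTE qb) andbF scale0r.
rewrite /phi exchange_big; apply: eq_bigr => j _.
rewrite mxE [in RHS](bigD1 j)//= [X in _ = _ + X]big1 ?addr0; last first.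
  by move=> k kj; rewrite mxE (negbTE kj) scale0r.
rewrite !mxE !eqxx scale1r; apply: eq_bigr => i _; by rewrite mxE.
Qed.

Lemma hat_bound m (u : 'M[H]_m) : exists K : R,
  forall (E : matNormedType R) (v : 'M[E]_n), mnorm v <= 1 ->
    mnorm (map_mx (phi v) u) <= K.
Proof.
have /choice[c cP] : forall qj : 'I_m * 'I_n, exists c : R,
    forall (E : matNormedType R) (v : 'M[E]_n),
    mnorm (mxactr (mxactl (\matrix_(p, i) (u p qj.1 : 'M[C]_n) qj.2 i) v)
      (delta_mx qj.2 qj.1)) <= c * mnorm v.
  by move=> [q j]; exact: mnorm_rect.
exists (\sum_q \sum_j `|c (q, j)|) => E v v1; rewrite map_phiE.
apply: le_trans (ler_mnorm_sum _ _) _; apply: ler_sum => q _.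
apply: le_trans (ler_mnorm_sum _ _) _; apply: ler_sum => j _.
apply: le_trans (cP (q, j) E v) _.
apply: le_trans (ler_norm _) _.
by rewrite normrM ler_piMr// ger0_norm ?mnorm_ge0.
Qed.

Lemma hat_has_sup m (u : 'M[H]_m) : has_sup (hat_set u).
Proof.
split.
  exists (mnorm (map_mx (phi (0 : 'M[opscalar R]_n)) u)), (opscalar R), 0.
  by rewrite mnorm0.
by have [K KP] := hat_bound u; exists K => _ [E [v [v1 ->]]]; exact: KP.
Qed.

Lemma hat_norm_ub m (u : 'M[H]_m) (E : matNormedType R) (v : 'M[E]_n) :
  mnorm v <= 1 -> mnorm (map_mx (phi v) u) <= hat_norm u.
Proof.
by move=> v1; apply: sup_upper_bound; [exact: hat_has_sup|exists E, v].
Qed.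

Lemma hat_norm_le m (u : 'M[H]_m) c :
  (forall (E : matNormedType R) (v : 'M[E]_n), mnorm v <= 1 ->
    mnorm (map_mx (phi v) u) <= c) -> hat_norm u <= c.
Proof.
move=> uc; apply: ge_sup; first by case: (hat_has_sup u).
by move=> _ [E [v [v1 ->]]]; exact: uc.
Qed.

Lemma hat_norm_ge0 m (u : 'M[H]_m) : 0 <= hat_norm u.
Proof.
apply: le_trans (mnorm_ge0 _) (@hat_norm_ub _ _ (opscalar R) 0 _).
by rewrite mnorm0.
Qed.

Let hat_eq0 m (u : 'M[H]_m) : hat_norm u = 0 -> u = 0.
Proof.
move=> u0; apply/matrixP => p q; rewrite [RHS]mxE.
apply/matrixP => j i; rewrite [RHS]mxE.
pose d : 'M[opscalar R]_n := delta_mx i j : 'M[C]_n.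
pose e := 1 + mnorm d.
have e0 : 0 < e by rewrite ltr_pwDl// mnorm_ge0.
have ne : normc (e^-1)%:C = e^-1.
  by rewrite /= expr0n addr0 sqrtr_sqr ger0_norm// invr_ge0 ltW.
have v1 : mnorm (mxscale (e^-1)%:C d) <= 1.
  by rewrite mnormZ ne mulrC ler_pdivrMr// mul1r lerDr.
have := hat_norm_ub u v1; rewrite u0 => le0.
have /mnorm_eq0/matrixP/(_ p q) :
    mnorm (map_mx (phi (mxscale (e^-1)%:C d)) u) = 0.
  by apply/eqP; rewrite eq_le le0 mnorm_ge0.
rewrite !mxE /phi (bigD1 i)//= [X in _ + X]big1 ?addr0; last first.
  move=> k ki; rewrite big1// => l _.
  by rewrite !mxE (negbTE ki)/= !scaler0.
rewrite (bigD1 j)//= [X in _ + X]big1 ?addr0; last first.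
  by move=> l lj; rewrite !mxE (negbTE lj) andbF !scaler0.
rewrite !mxE !eqxx /= => /eqP; rewrite /GRing.scale/= mulr1 mulf_eq0.
move=> /orP[/eqP//|/eqP ze].
by have := ne; rewrite ze normc0 => /esym/eqP; rewrite invr_eq0 gt_eqF.
Qed.

Let hat_normD m (u w : 'M[H]_m) : hat_norm (u + w) <= hat_norm u + hat_norm w.
Proof.
apply: hat_norm_le => E v v1.
have -> : map_mx (phi v) (u + w) = map_mx (phi v) u + map_mx (phi v) w.
  by apply/matrixP => p q; rewrite !mxE raddfD.
by rewrite (le_trans (ler_mnormD _ _))// lerD// hat_norm_ub.
Qed.

Let map_phiZ m a (u : 'M[H]_m) (E : matNormedType R) (v : 'M[E]_n) :
  map_mx (phi v) (mxscale a u) = mxscale a (map_mx (phi v) u).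
Proof. by apply/matrixP => p q; rewrite !mxE linearZ. Qed.

Let hat_normZ_le m a (u : 'M[H]_m) :
  hat_norm (mxscale a u) <= normc a * hat_norm u.
Proof.
apply: hat_norm_le => E v v1.
by rewrite map_phiZ mnormZ ler_wpM2l ?normc_ge0// hat_norm_ub.
Qed.

Let hat_normZ m a (u : 'M[H]_m) :
  hat_norm (mxscale a u) = normc a * hat_norm u.
Proof.
apply/eqP; rewrite eq_le hat_normZ_le/=.
have [->|a0] := eqVneq a 0; first by rewrite normc0 mul0r hat_norm_ge0.
have na0 : 0 < normc a.
  rewrite lt_neqAle normc_ge0 andbT eq_sym.
  by apply: contra a0 => /eqP/eq0_normc->.
rewrite mulrC -ler_pdivlMr// mulrC -normcV.
rewrite (le_trans _ (hat_normZ_le _ _))// (_ : mxscale _ (mxscale _ _) = u)//.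
by apply/matrixP => p q; rewrite !mxE scalerK.
Qed.

Let hat_dsum0 m k (u : 'M[H]_m) :
  hat_norm (block_mx u 0 0 (0 : 'M[H]_k)) = hat_norm u.
Proof.
congr sup; apply/seteqP.
have e (E : matNormedType R) (v : 'M[E]_n) :
    mnorm (map_mx (phi v) (block_mx u 0 0 (0 : 'M[H]_k))) =
    mnorm (map_mx (phi v) u).
  have z a b : map_mx (phi v) (0 : 'M[H]_(a, b)) = 0.
    by apply/matrixP => p q; rewrite !mxE raddf0.
  by rewrite map_block_mx !z mnorm_dsum0.
by split=> [_ [E [v [v1 ->]]]|_ [E [v [v1 ->]]]]; exists E, v; split.
Qed.

Let hat_actl m (S : 'M[C]_m) (u : 'M[H]_m) :
  hat_norm (mxactl S u) <= opnorm S * hat_norm u.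
Proof.
apply: hat_norm_le => E v v1.
have -> : map_mx (phi v) (mxactl S u) = mxactl S (map_mx (phi v) u).
  apply/matrixP => p q; rewrite !mxE raddf_sum; apply: eq_bigr => k _.
  by rewrite [in RHS]mxE -linearZ.
by rewrite (le_trans (mnorm_actl _ _))// ler_wpM2l ?opnorm_ge0// hat_norm_ub.
Qed.

Let hat_actr m (u : 'M[H]_m) (S : 'M[C]_m) :
  hat_norm (mxactr u S) <= hat_norm u * opnorm S.
Proof.
apply: hat_norm_le => E v v1.
have -> : map_mx (phi v) (mxactr u S) = mxactr (map_mx (phi v) u) S.
  apply/matrixP => p q; rewrite !mxE raddf_sum; apply: eq_bigr => k _.
  by rewrite [in RHS]mxE -linearZ.
by rewrite (le_trans (mnorm_actr _ _))// ler_wpM2r ?opnorm_ge0// hat_norm_ub.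
Qed.

HB.instance Definition _ := isMatNormed.Build R H
  hat_eq0 hat_normD hat_normZ hat_dsum0 hat_actl hat_actr.

End HatNorm.

Section L1Sum.
Variables (R : realType) (I : choiceType) (E : I -> matNormedType R).
Local Notation C := R[i].

Record l1sum := L1Sum {
  l1coord :> forall i, E i;
  l1finite : finite_set [set i | l1coord i != 0] }.

Lemma l1sum_eqP (f g : l1sum) : (forall i, f i = g i) -> f = g.
Proof.
case: f g => [f Ff] [g Fg] /= fg.
have e : f = g by exact: functional_extensionality_dep.
by case: g / e Fg {fg} => Fg; congr L1Sum.
Qed.

HB.instance Definition _ := gen_eqMixin l1sum.
HB.instance Definition _ := gen_choiceMixin l1sum.

Let l1zero_fin : finite_set [set i | (fun i => 0 : E i) i != 0].
Proof. by apply: (sub_finite_set _ (finite_set0 I)) => i /=; rewrite eqxx. Qed.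
Definition l1zero := L1Sum l1zero_fin.

Let l1opp_fin (f : l1sum) : finite_set [set i | (fun i => - f i) i != 0].
Proof. by apply: sub_finite_set (l1finite f) => i /=; rewrite oppr_eq0. Qed.
Definition l1opp f := L1Sum (l1opp_fin f).

Let l1add_fin (f g : l1sum) : finite_set [set i | (fun i => f i + g i) i != 0].
Proof.
have: finite_set ([set i | f i != 0] `|` [set i | g i != 0]).
  by rewrite finite_setU; split; exact: l1finite.
apply: sub_finite_set => i /=; have [->|] := eqVneq (f i) 0; last by left.
by rewrite add0r; right.
Qed.
Definition l1add f g := L1Sum (l1add_fin f g).

Let l1scale_fin (a : C) (f : l1sum) :
  finite_set [set i | (fun i => a *: f i) i != 0].
Proof.
apply: sub_finite_set (l1finite f) => i /=; apply: contra => /eqP->.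
by rewrite scaler0.
Qed.
Definition l1scale a f := L1Sum (l1scale_fin a f).

Let l1addA : associative l1add.
Proof. by move=> f g h; apply: l1sum_eqP => i; exact: addrA. Qed.
Let l1addC : commutative l1add.
Proof. by move=> f g; apply: l1sum_eqP => i; exact: addrC. Qed.
Let l1add0 : left_id l1zero l1add.
Proof. by move=> f; apply: l1sum_eqP => i; exact: add0r. Qed.
Let l1addN : left_inverse l1zero l1opp l1add.
Proof. by move=> f; apply: l1sum_eqP => i; exact: addNr. Qed.

HB.instance Definition _ :=
  GRing.isZmodule.Build l1sum l1addA l1addC l1add0 l1addN.

Let l1scaleA a b f : l1scale a (l1scale b f) = l1scale (a * b) f.
Proof. by apply: l1sum_eqP => i; exact: scalerA. Qed.
Let l1scale1 : left_id 1 l1scale.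
Proof. by move=> f; apply: l1sum_eqP => i; exact: scale1r. Qed.
Let l1scaleDr : right_distributive l1scale +%R.
Proof. by move=> a f g; apply: l1sum_eqP => i; exact: scalerDr. Qed.
Let l1scaleDl f : {morph l1scale^~ f : a b / a + b}.
Proof. by move=> a b; apply: l1sum_eqP => i; exact: scalerDl. Qed.

HB.instance Definition _ := GRing.Zmodule_isLmodule.Build C l1sum
  l1scaleA l1scale1 l1scaleDr l1scaleDl.

Definition l1proj i (f : l1sum) : E i := f i.

Lemma l1proj_is_linear i : linear (l1proj i).
Proof. by []. Qed.

HB.instance Definition _ i :=
  GRing.isLinear.Build C l1sum (E i) *:%R (l1proj i) (l1proj_is_linear i).

(* The summand indexed by i is 0 for all but finitely many i, so that this    *)
(* finitely supported sum is the actual sum.                                  *)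
Definition l1norm m (u : 'M[l1sum]_m) : R :=
  \sum_(i \in [set: I]) mnorm (map_mx (l1proj i) u).

Lemma l1norm_finite m (u : 'M[l1sum]_m) :
  finite_set [set i | map_mx (l1proj i) u != 0].
Proof.
have: finite_set (\bigcup_(pq in [set: 'I_m * 'I_m])
    [set i | u pq.1 pq.2 i != 0]).
  by apply: bigcup_finite => // pq _; exact: l1finite.
apply: sub_finite_set => i /= ui; apply: contrapT => ui0.
case/eqP: ui; apply/matrixP => p q; rewrite !mxE.
by apply: contrapT => /eqP upq; apply: ui0; exists (p, q).
Qed.

Lemma l1norm_widen m (u : 'M[l1sum]_m) (A : {fset I}) :
  [set i | map_mx (l1proj i) u != 0] `<=` [set` A] ->
  l1norm u = \sum_(i <- A) mnorm (map_mx (l1proj i) u).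
Proof.
move=> uA; apply: fsbigTE => i; apply: contraNeq => ui; apply: uA => /=.
by apply: contra_neq ui => ->; rewrite mnorm0.
Qed.

Lemma l1norm_supp2 m n (u : 'M[l1sum]_m) (w : 'M[l1sum]_n) :
  exists A : {fset I},
    [set i | map_mx (l1proj i) u != 0] `<=` [set` A] /\
    [set i | map_mx (l1proj i) w != 0] `<=` [set` A].
Proof.
have : finite_set ([set i | map_mx (l1proj i) u != 0] `|`
                   [set i | map_mx (l1proj i) w != 0]).
  by rewrite finite_setU; split; exact: l1norm_finite.
move=> /finite_fsetP[A AE]; exists A; rewrite -AE.
by split=> i; [left|right].
Qed.

Let l1norm_eq0 m (u : 'M[l1sum]_m) : l1norm u = 0 -> u = 0.
Proof.
have [A [uA _]] := l1norm_supp2 u u; rewrite (l1norm_widen uA) => /eqP.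
rewrite psumr_eq0 => [/allP uA0|i _]; last exact: mnorm_ge0.
apply/matrixP => p q; rewrite mxE; apply: l1sum_eqP => i.
suff /matrixP/(_ p q) : map_mx (l1proj i) u = 0 by rewrite !mxE.
apply: contrapT => /eqP ui; have /uA0/= /eqP/mnorm_eq0 u0 := uA _ ui.
by rewrite u0 eqxx in ui.
Qed.

Let l1normD m (u w : 'M[l1sum]_m) : l1norm (u + w) <= l1norm u + l1norm w.
Proof.
have [A [uA wA]] := l1norm_supp2 u w.
have e i : map_mx (l1proj i) (u + w) = map_mx (l1proj i) u + map_mx (l1proj i) w.
  by apply/matrixP => p q; rewrite !mxE raddfD.
rewrite (l1norm_widen uA) (l1norm_widen wA) (@l1norm_widen _ (u + w) A).
  by rewrite -big_split; apply: ler_sum => i _; rewrite e ler_mnormD.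
move=> i /=; rewrite e; have [->|/uA//] := eqVneq (map_mx (l1proj i) u) 0.
by rewrite add0r => /wA.
Qed.

Let l1normZ m a (u : 'M[l1sum]_m) : l1norm (mxscale a u) = normc a * l1norm u.
Proof.
rewrite /l1norm mulr_fsumr; apply: eq_fsbigr => i _.
by rewrite -mnormZ; congr mnorm; apply/matrixP => p q; rewrite !mxE linearZ.
Qed.

Let l1norm_dsum0 m n (u : 'M[l1sum]_m) :
  l1norm (block_mx u 0 0 (0 : 'M[l1sum]_n)) = l1norm u.
Proof.
apply: eq_fsbigr => i _.
have z a b : map_mx (l1proj i) (0 : 'M[l1sum]_(a, b)) = 0.
  by apply/matrixP => p q; rewrite !mxE raddf0.
by rewrite map_block_mx !z mnorm_dsum0.
Qed.

Let l1norm_actl m (S : 'M[C]_m) (u : 'M[l1sum]_m) :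
  l1norm (mxactl S u) <= opnorm S * l1norm u.
Proof.
have [A [SA uA]] := l1norm_supp2 (mxactl S u) u.
rewrite (l1norm_widen SA) (l1norm_widen uA) mulr_sumr; apply: ler_sum => i _.
have -> : map_mx (l1proj i) (mxactl S u) = mxactl S (map_mx (l1proj i) u).
  apply/matrixP => p q; rewrite !mxE raddf_sum; apply: eq_bigr => k _.
  by rewrite [in RHS]mxE -linearZ.
exact: mnorm_actl.
Qed.

Let l1norm_actr m (u : 'M[l1sum]_m) (S : 'M[C]_m) :
  l1norm (mxactr u S) <= l1norm u * opnorm S.
Proof.
have [A [SA uA]] := l1norm_supp2 (mxactr u S) u.
rewrite (l1norm_widen SA) (l1norm_widen uA) mulr_suml; apply: ler_sum => i _.
have -> : map_mx (l1proj i) (mxactr u S) = mxactr (map_mx (l1proj i) u) S.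
  apply/matrixP => p q; rewrite !mxE raddf_sum; apply: eq_bigr => k _.
  by rewrite [in RHS]mxE -linearZ.
exact: mnorm_actr.
Qed.

HB.instance Definition _ := isMatNormed.Build R l1sum
  l1norm_eq0 l1normD l1normZ l1norm_dsum0 l1norm_actl l1norm_actr.

End L1Sum.

Section MN1.
Variable R : realType.
Implicit Types E F G : matNormedType R.

Definition completely_contractive E F (f : E -> F) : Prop :=
  forall m (u : 'M[E]_m), mnorm (map_mx f u) <= mnorm u.

Record mn1Hom E F := MN1Hom {
  mn1_fun :> {linear E -> F};
  mn1_cc : completely_contractive mn1_fun }.

Lemma mn1_comp_cc E F G (g : mn1Hom F G) (f : mn1Hom E F) :
  completely_contractive (g \o f).
Proof.
by move=> m u; rewrite map_mx_comp (le_trans (mn1_cc g _))// mn1_cc.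
Qed.

Definition mn1_comp E F G (g : mn1Hom F G) (f : mn1Hom E F) : mn1Hom E G :=
  MN1Hom (mn1_comp_cc g f).

Definition mball E m : Type := {w : 'M[E]_m | mnorm w <= 1}.

(* The factor of index m is the unit ball of M_{m+1}(E).                      *)
Definition odot E : Type := forall m : nat, mball E m.+1.

Lemma mball_map_subproof E F (f : mn1Hom E F) m (w : mball E m) :
  mnorm (map_mx f (sval w)) <= 1.
Proof. exact: le_trans (mn1_cc f _) (svalP w). Qed.

Definition odot_map E F (f : mn1Hom E F) (w : odot E) : odot F :=
  fun m => exist _ (map_mx f (sval (w m))) (mball_map_subproof f (w m)).

Definition metrically_free (M : Type) (Fr : matNormedType R) : Prop :=
  exists b : forall E, (M -> odot E) -> mn1Hom Fr E,
    (forall E, bijective (b E)) /\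
    (forall E F (f : mn1Hom E F) (g : M -> odot E),
       b F (odot_map f \o g) = mn1_comp f (b E g)).

(* The family starts at \widehat M_1.                                         *)
Definition hatM_infty : matNormedType R :=
  l1sum (fun n : nat => hatM R n.+1 : matNormedType R).

End MN1.

(* Main.v *)
(* The elementary matrices form a tautological element of M_n(\widehat M_n), of
   norm at most 1 because phi v sends it to v. Hence v |-> phi v identifies the
   unit ball of M_n(E) with the completely contractive operators from
   \widehat M_n to E. The matricial l_1-sum is the coproduct in MN_1, so a
   completely contractive operator on \widehat M_\infty is a sequence of
   elements of the unit balls of the M_n(E), that is, a point of odot E. *)
Require Import Defs.
From HB Require Import structures.
From mathcomp Require Import all_boot all_order all_algebra.
From mathcomp Require Import all_classical all_reals.
From mathcomp.real_closed Require Import complex.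
From mathcomp Require Import finmap.

Set Implicit Arguments.
Unset Strict Implicit.
Unset Printing Implicit Defensive.

Import Order.TTheory GRing.Theory Num.Theory.

Local Open Scope ring_scope.
Local Open Scope complex_scope.
Local Open Scope classical_set_scope.

(** Bundled maps also carry proofs, so proof irrelevance is needed to get the equalities of
    morphisms that bijectivity and naturality ask for. *)
Lemma linear_eqP (K : pzRingType) (U V : lmodType K) (f g : {linear U -> V}) :
  f =1 g -> f = g.
Proof.
case: f g => [f [[f1] [f2]]] [g [[g1] [g2]]] /= /funext fg.
case: g / fg g1 g2 => g1 g2.
by rewrite (Prop_irrelevance f1 g1) (Prop_irrelevance f2 g2).
Qed.

(** Source of the naturality of the final bijection, summand by summand. *)
Lemma phi_map_linear (K : comPzRingType) (E F : lmodType K) n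
    (f : {linear E -> F}) (v : 'M[E]_n) (a : 'M[K]_n) :
  phi (map_mx f v) a = f (phi v a).
Proof.
rewrite /phi raddf_sum; apply: eq_bigr => i _.
rewrite raddf_sum; apply: eq_bigr => j _; rewrite mxE; exact/esym/linearZ_LR.
Qed.

Section Morphisms.
Variable R : realType.
Implicit Types E F : matNormedType R.

Lemma mn1Hom_eqP E F (f g : mn1Hom E F) : f =1 g -> f = g.
Proof.
case: f g => [f cf] [g cg] /= /linear_eqP fg; case: g / fg cg => cg.
by rewrite (Prop_irrelevance cf cg).
Qed.

Lemma mball_eqP E m (v w : mball E m) : sval v = sval w -> v = w.
Proof.
case: v w => [v v1] [w w1] /= vw; case: w / vw w1 => w1.
by rewrite (Prop_irrelevance v1 w1).
Qed.

End Morphisms.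

Section Coproduct.
Variables (R : realType) (I : choiceType) (E : I -> matNormedType R).
Local Notation S := (l1sum E).

(** [eqtype.dfwith] overwrites the zero family at [i] and takes care of the transport from [E i] to
    [E j] when [j = i]. *)
Lemma l1inj_finite i (a : E i) :
  finite_set [set j | eqtype.dfwith (fun j => 0 : E j) a j != 0].
Proof.
apply: sub_finite_set (finite_set1 i) => j /=; apply: contra_neqP => /eqP ji.
by rewrite eqtype.dfwith_out// eq_sym.
Qed.

Definition l1inj i (a : E i) : S := L1Sum (l1inj_finite a).

Lemma l1injE i (a : E i) : l1inj a i = a.
Proof. exact: eqtype.dfwith_in. Qed.

Lemma l1inj_out i j (a : E i) : j != i -> l1inj a j = 0.
Proof. by move=> ji; rewrite /= eqtype.dfwith_out// eq_sym. Qed.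

Lemma l1inj_is_linear i : linear (@l1inj i).
Proof.
move=> c a b; apply: l1sum_eqP => j.
rewrite -[RHS]/(c *: l1inj a j + l1inj b j).
have [->|ji] := eqVneq j i; first by rewrite !l1injE.
by rewrite !l1inj_out// scaler0 addr0.
Qed.

HB.instance Definition _ i :=
  GRing.isLinear.Build R[i] (E i) S *:%R (@l1inj i) (@l1inj_is_linear i).

Lemma l1sum_supp (x : S) : exists A : {fset I}, forall i, i \notin A -> x i = 0.
Proof.
have /finite_fsetP[A AE] := l1finite x; exists A => i.
apply: contraNeq => xi; suff : [set` A] i by [].
by rewrite -AE.
Qed.

Lemma l1sum_decomp (x : S) (A : {fset I}) :
  (forall i, i \notin A -> x i = 0) -> x = \sum_(i <- A) l1inj (x i).
Proof.
move=> xA; apply: l1sum_eqP => j; rewrite -[RHS]/(l1proj j _) raddf_sum.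
have [jA|/[dup] jA /xA ->] := boolP (j \in A).
  rewrite (big_fsetD1 j)//= big_seq big1 ?addr0; first exact/esym/l1injE.
  move=> i; rewrite !inE => /andP[ij _].
  by rewrite [LHS]l1inj_out// eq_sym.
rewrite big_seq big1// => i iA; rewrite [LHS]l1inj_out//.
by apply: contraNneq jA => ->.
Qed.

Lemma l1inj_cc i : completely_contractive (@l1inj i).
Proof.
(* Only the summand [i] contributes to the norm, so the inequality is in fact an equality. *)
move=> m u; rewrite [X in X <= _](@l1norm_widen _ _ _ _ _ [fset i]%fset).
  rewrite big_seq_fset1 le_eqVlt; apply/orP; left; apply/eqP; congr mnorm.
  by apply/matrixP => p q; rewrite !mxE; exact: l1injE.
move=> j /=; rewrite inE; apply: contra_neqT => ji.
by apply/matrixP => p q; rewrite !mxE; exact: l1inj_out.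
Qed.

Definition l1inj_hom i : mn1Hom (E i) S := MN1Hom (@l1inj_cc i).

Variables (F : matNormedType R) (f : forall i, mn1Hom (E i) F).

(** A nonzero term forces [x i != 0], so the support is finite and the sum never takes its default
    value. *)
Definition l1copair (x : S) : F := \sum_(i \in [set: I]) f i (x i).

Lemma l1copairE (x : S) (A : {fset I}) :
  (forall i, i \notin A -> x i = 0) -> l1copair x = \sum_(i <- A) f i (x i).
Proof. by move=> xA; apply: fsbigTE => i /xA ->; exact: raddf0. Qed.

Lemma l1copair_is_linear : linear l1copair.
Proof.
move=> c x y; have [A xA] := l1sum_supp x; have [B yB] := l1sum_supp y.
(* The union of the two supports serves [x], [y] and [c *: x + y] at once. *)
have xAB i : i \notin (A `|` B)%fset -> x i = 0.
  by rewrite inE negb_or => /andP[/xA].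
have yAB i : i \notin (A `|` B)%fset -> y i = 0.
  by rewrite inE negb_or => /andP[_ /yB].
rewrite (l1copairE xAB) (l1copairE yAB) (@l1copairE _ (A `|` B)%fset).
  by rewrite scaler_sumr -big_split; apply: eq_bigr => i _; exact: linearP.
move=> i iAB; rewrite -[LHS]/(c *: x i + y i).
by rewrite xAB// yAB// scaler0 addr0.
Qed.

HB.instance Definition _ :=
  GRing.isLinear.Build R[i] S F *:%R l1copair l1copair_is_linear.

(** The triangle inequality bounds the image by the sum of the norms of the components, which is
    exactly the l_1 norm. *)
Lemma l1copair_cc : completely_contractive l1copair.
Proof.
move=> m u; have [A [uA _]] := l1norm_supp2 u u.
have -> : map_mx l1copair u = \sum_(i <- A) map_mx (f i) (map_mx (@l1proj _ _ E i) u).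
  apply/matrixP => p q; rewrite mxE summxE (@l1copairE _ A).
    by apply: eq_bigr => i _; rewrite !mxE.
  move=> i; apply: contraNeq => ui; apply: uA => /=.
  by apply: contra_neq ui => /matrixP/(_ p q); rewrite !mxE.
rewrite [X in _ <= X](l1norm_widen uA).
apply: le_trans (ler_mnorm_sum _ _) _; apply: ler_sum => i _; exact: mn1_cc.
Qed.

Definition l1copair_hom : mn1Hom S F := MN1Hom l1copair_cc.

Lemma l1copair_inj i (a : E i) : l1copair (l1inj a) = f i a.
Proof.
rewrite (@l1copairE _ [fset i]%fset) ?big_seq_fset1 ?l1injE// => j.
by rewrite inE; exact: l1inj_out.
Qed.

End Coproduct.

(** Uniqueness in the coproduct: without completion, every element is a finite sum of injected
    ones. *)
Lemma mn1Hom_l1sum_eqP (R : realType) (I : choiceType) (E : I -> matNormedType R)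
    (F : matNormedType R) (f g : mn1Hom (l1sum E) F) :
  (forall i (a : E i), f (l1inj a) = g (l1inj a)) -> f = g.
Proof.
move=> fg; apply: mn1Hom_eqP => x; have [A /l1sum_decomp ->] := l1sum_supp x.
by rewrite !raddf_sum; apply: eq_bigr => i _; exact: fg.
Qed.

Section HatMUniversal.
Variables (R : realType) (n : nat).
Implicit Types E F : matNormedType R.

(** The indices are transposed because [phi v] pairs [a j i] with [v i j]: it sends [delta_mx j i]
    to [v i j]. *)
Definition hat_unit : 'M[hatM R n]_n := \matrix_(i, j) (delta_mx j i : 'M[R[i]]_n).

Lemma map_phi_hat_unit E (v : 'M[E]_n) : map_mx (phi v) hat_unit = v.
Proof.
apply/matrixP => i j; rewrite !mxE /phi (bigD1 i)//= (bigD1 j)//=.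
rewrite mxE !eqxx scale1r big1 ?addr0 => [|k kj]; last first.
  by rewrite mxE (negbTE kj) scale0r.
rewrite big1 ?addr0// => k ki; rewrite big1// => l _.
by rewrite mxE (negbTE ki) andbF scale0r.
Qed.

Lemma mnorm_hat_unit : mnorm hat_unit <= 1.
Proof. by apply: hat_norm_le => E v; rewrite map_phi_hat_unit. Qed.

(** A linear map is determined by its values on the matrix units, which are the entries of
    [hat_unit]. *)
Lemma phi_map_hat_unit E (h : {linear hatM R n -> E}) (a : hatM R n) :
  phi (map_mx h hat_unit) a = h a.
Proof.
rewrite [in RHS](matrix_sum_delta (a : 'M[R[i]]_n)) exchange_big /=.
rewrite raddf_sum; apply: eq_bigr => i _; rewrite raddf_sum; apply: eq_bigr => j _.
by rewrite !mxE; exact/esym/linearZ_LR.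
Qed.

(** The norm of [hatM] is a supremum over all such [v], hence bounds each of them. *)
Lemma phi_cc E (v : mball E n) :
  completely_contractive (phi (sval v) : hatM R n -> E).
Proof.
by move=> m u; exact: hat_norm_ub (svalP v).
Qed.

Definition phi_hom E (v : mball E n) : mn1Hom (hatM R n) E :=
  @MN1Hom _ (hatM R n) E (phi (sval v)) (phi_cc v).

End HatMUniversal.

Section FreeObject.
Variable R : realType.
Implicit Types E F : matNormedType R.

Let hat_family (n : nat) : matNormedType R := hatM R n.+1.

Definition free_ext E (w : unit -> odot E) : mn1Hom (hatM_infty R) E :=
  l1copair_hom (fun n => phi_hom (w tt n)).

(** The universal point: it corresponds to the identity of [hatM_infty], and the inverse bijection
    evaluates morphisms at it. *)
Definition odot_unit : odot (hatM_infty R) := fun n =>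
  exist _ (map_mx (@l1inj_hom R nat hat_family n) (hat_unit R n.+1))
    (le_trans (mn1_cc _ _) (mnorm_hat_unit R n.+1)).

Definition free_res E (h : mn1Hom (hatM_infty R) E) : unit -> odot E :=
  fun=> odot_map h odot_unit.

Lemma free_extK E : cancel (@free_ext E) (@free_res E).
Proof.
move=> w; apply: funext => -[]; apply: functional_extensionality_dep => n.
apply: mball_eqP; rewrite /= -[RHS]map_phi_hat_unit -map_mx_comp.
by apply/matrixP => i j; rewrite [LHS]mxE [RHS]mxE; exact: l1copair_inj.
Qed.

Lemma free_resK E : cancel (@free_res E) (@free_ext E).
Proof.
move=> h; apply: mn1Hom_l1sum_eqP => n a.
rewrite [LHS]l1copair_inj /= -map_mx_comp.
(* The restriction of [h] to the summand [n] is recovered from its value on [hat_unit]. *)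
exact: phi_map_hat_unit (mn1_fun (mn1_comp h (@l1inj_hom R nat hat_family n))) a.
Qed.

Lemma free_ext_natural E F (f : mn1Hom E F) (w : unit -> odot E) :
  free_ext (odot_map f \o w) = mn1_comp f (free_ext w).
Proof.
apply: mn1Hom_l1sum_eqP => n a; rewrite [LHS]l1copair_inj /=.
by rewrite l1copair_inj; exact: phi_map_linear.
Qed.

End FreeObject.

Theorem theorem3 (R : realType) : metrically_free unit (hatM_infty R).
Proof.
exists (@free_ext R); split=> [E|]; last exact: free_ext_natural.
by exists (@free_res R E); [exact: free_extK|exact: free_resK].
Qed.
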